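(* Let $k$ be an uncountable algebraically closed field of characteristic $p>0$, $p\neq 2$, and let $R=k[[x_0,\dots,x_d]]/(f)$ be a $d$-dimensional singular (i.e. non-regular) hypersurface. Then $$\operatorname{e}_{HK}\Big(k[[x_0,\dots,x_d]]/\big(\textstyle\sum_{i=0}^d x_i^2\big)\Big)\le \operatorname{e}_{HK}(R).$$
   Context: For a $d$-dimensional Noetherian local ring $(A,\mathfrak m)$ of characteristic $p>0$, $\mathfrak m^{[q]}=(a^q:a\in\mathfrak m)$ for $q=p^e$, and $\operatorname{e}_{HK}(A)=\lim_{q\to\infty}\lambda(A/\mathfrak m^{[q]})/q^d$, where $\lambda$ denotes length. *)

(* Defs.v *)
From HB Require Import structures.
From mathcomp Require Import all_boot all_order all_algebra.
From mathcomp Require Import all_classical all_reals all_analysis.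
Set Implicit Arguments. Unset Strict Implicit. Unset Printing Implicit Defensive.
Import Order.TTheory GRing.Theory Num.Theory numFieldNormedType.Exports.
Local Open Scope classical_set_scope.
Local Open Scope ring_scope.

Definition monom (n : nat) := {ffun 'I_n -> nat}.

Definition powser (k : fieldType) (n : nat) := monom n -> k.

Section PS.
Variables (k : fieldType) (n : nat).
Implicit Types F G : powser k n.

Definition mon0 : monom n := [ffun _ => 0%N].
Definition ps_zero : powser k n := fun _ => 0.
Definition ps_one : powser k n := fun m => (m == mon0)%:R.
Definition ps_add F G : powser k n := fun m => F m + G m.
(* Cauchy product: (FG)_m = sum_{a + b = m} F_a G_b ; a ranges over a <= m. *)
Definition ps_mul F G : powser k n := fun m =>
  \sum_(a : {ffun 'I_n -> 'I_(\sum_(i < n) m i).+1} | [forall i, (a i <= m i)%N])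
     F [ffun i => nat_of_ord (a i)] * G [ffun i => (m i - a i)%N].
Definition ps_pow F (q : nat) : powser k n := iter q (ps_mul F) ps_one.
Definition ps_var (i : 'I_n) : powser k n :=
  fun m => (m == [ffun j => nat_of_bool (j == i)])%:R.

Definition maxideal : set (powser k n) := [set F | F mon0 = 0].

Definition is_ideal (I : set (powser k n)) : Prop :=
  [/\ I ps_zero, (forall F G, I F -> I G -> I (ps_add F G))
    & (forall s F, I F -> I (ps_mul s F))].

Definition ideal_gen (S : set (powser k n)) : set (powser k n) :=
  [set F | forall I, is_ideal I -> S `<=` I -> I F].

(* existence of a strictly increasing chain of ideals J = I_0 < ... < I_N = whole ring;
   via the correspondence theorem these are the chains of submodules of S/J *)
Definition has_chain (J : set (powser k n)) (N : nat) : Prop :=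
  exists c : nat -> set (powser k n),
    [/\ c 0%N = J, c N = setT, (forall i, (i <= N)%N -> is_ideal (c i))
      & (forall i, (i < N)%N -> c i `<` c i.+1)].

Definition qlength (R : realType) (J : set (powser k n)) : R :=
  sup [set (N%:R : R) | N in has_chain J].

(* preimage in S of the Frobenius power m_A^[q] of the maximal ideal of A = S/(f):
   the ideal generated by f and all a^q, a in the maximal ideal of S *)
Definition frob_ideal (f : powser k n) (q : nat) : set (powser k n) :=
  ideal_gen ([set f] `|` [set ps_pow a q | a in maxideal]).

End PS.

Definition quadric (k : fieldType) (n : nat) : powser k n :=
  foldr (@ps_add k n) (@ps_zero k n) [seq ps_mul (@ps_var k n i) (@ps_var k n i) | i <- enum 'I_n].

Definition eHK (R : realType) (k : fieldType) (p d : nat) (f : powser k d.+1) : R :=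
  limn ((fun e : nat => qlength R (frob_ideal f (p ^ e)) / ((p ^ e) ^ d)%:R) : R^nat).

Definition uncountable (T : Type) : Prop := ~ exists g : nat -> T, forall y : T, exists i : nat, g i = y.

(* Main.v *)
(** Write S = k[[x_0, ..., x_d]]. For q a power of p, the length of
    S / (f, m^[q]) is the corank c_f(q) of multiplication by f on the
    q^(d+1)-dimensional algebra S / m^[q].

    The sequence c_f(q) / q^d converges because it is bounded and nondecreasing.
    Boundedness: if x^u is the initial monomial of f for a weight order, the
    multiples x^a f with x^(a+u) not in m^[q] are independent, so
    c_f(q) <= |u| q^d. Monotonicity: Frobenius gives
    p^(d+1) c_f(q) <= c_(f^p)(pq), and corank is subadditive under products,
    so c_(f^p)(pq) <= p c_f(pq).

    It remains to compare c_f with c_Q, Q = sum x_i^2, for a fixed q. As f is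
    singular it lies in m^2, so f = x^T B x with B symmetric over S. For all but
    finitely many s in k, the rank of multiplication by f - s Q is at least that of
    f, and B(0) - s is invertible. Modulo a high power of m, the symmetric matrix
    B - s then has a symmetric square root P, so that f - s Q = sum y_i^2 modulo
    m^[q] with y = P x. The substitution x_i |-> y_i is an automorphism of
    S / m^[q] taking Q to f - s Q, hence c_Q(q) = c_(f - s Q)(q) <= c_f(q). *)

Require Import Defs.
From HB Require Import structures.
From mathcomp Require Import all_boot all_order all_algebra.
From mathcomp Require Import all_classical all_reals all_analysis.
From mathcomp Require Import zify ring.
Set Implicit Arguments. Unset Strict Implicit. Unset Printing Implicit Defensive.
Import Order.TTheory GRing.Theory Num.Theory numFieldNormedType.Exports.
Local Open Scope classical_set_scope.
Local Open Scope ring_scope.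

Lemma exists_argmin_nat (T : Type) (A : set T) (g : T -> nat) : A !=set0 ->
  exists2 x, A x & forall y, A y -> (g x <= g y)%N.
Proof.
move=> [x0 Ax0].
have exA : exists m, `[< exists2 x, A x & g x = m >].
  by exists (g x0); apply/asboolP; exists x0.
case: (ex_minnP exA) => m /asboolP[x Ax <-] gmin; exists x => // y Ay.
by apply: gmin; apply/asboolP; exists y.
Qed.

(** * Monomials *)

Section Monomials.
Variable n : nat.
Implicit Types (a b m : monom n) (q : nat).

Definition msub a b : monom n := [ffun i => (a i - b i)%N].
Definition mvar (i : 'I_n) : monom n := [ffun j => nat_of_bool (j == i)].
Definition mdvd a b := [forall i, (a i <= b i)%N].
Definition mdeg a := (\sum_i a i)%N.

Definition box q : seq (monom n) :=
  [seq [ffun i => nat_of_ord (a i)] | a : {ffun 'I_n -> 'I_q}].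

Lemma maddE a b i : (a + b) i = (a i + b i)%N. Proof. by rewrite ffunE. Qed.

Lemma mmulnE a q i : (a *+ q) i = (q * a i)%N.
Proof. by rewrite ffunMnE -mulr_natl natn. Qed.

Lemma mdvdP a b : reflect (forall i, (a i <= b i)%N) (mdvd a b).
Proof. exact: forallP. Qed.

Lemma msubm0 m : msub m 0 = m.
Proof. by apply/ffunP=> i; rewrite !ffunE subn0. Qed.

Lemma maddK a b : msub (a + b) a = b.
Proof. by apply/ffunP=> i; rewrite ffunE maddE addKn. Qed.

Lemma msubK a b : mdvd a b -> a + msub b a = b.
Proof. by move=> /mdvdP ab; apply/ffunP=> i; rewrite maddE ffunE subnKC. Qed.

Lemma mdvd0 m : mdvd 0 m. Proof. by apply/mdvdP => i; rewrite ffunE. Qed.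

Lemma mdvd_add a b : mdvd a (a + b).
Proof. by apply/mdvdP=> i; rewrite maddE leq_addr. Qed.

Lemma mdvd_msub m a : mdvd (msub m a) m.
Proof. by apply/mdvdP => i; rewrite ffunE leq_subr. Qed.

Lemma madd_eqE a b m : (a + b == m) = mdvd a m && (b == msub m a).
Proof.
apply/eqP/andP => [<-|[am /eqP ->]]; last exact: msubK.
by rewrite mdvd_add maddK.
Qed.

Lemma madd_inj a : injective (fun b => a + b).
Proof. by move=> b c e; rewrite -(maddK a b) e maddK. Qed.

Lemma mdegD a b : mdeg (a + b) = (mdeg a + mdeg b)%N.
Proof. by rewrite /mdeg -big_split; apply: eq_bigr => i _; rewrite maddE. Qed.

Lemma mdegMn a q : mdeg (a *+ q) = (q * mdeg a)%N.
Proof. by rewrite /mdeg big_distrr; apply: eq_bigr => i _; rewrite mmulnE. Qed.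

Lemma mdeg_var i : mdeg (mvar i) = 1%N.
Proof.
rewrite /mdeg (bigD1 i) //= big1 => [|j ji]; rewrite ffunE ?eqxx //.
by rewrite (negbTE ji).
Qed.

Lemma leq_mdeg m i : (m i <= mdeg m)%N.
Proof. by rewrite /mdeg (bigD1 i) //= leq_addr. Qed.

Lemma mdeg_eq0 m : (mdeg m == 0%N) = (m == 0).
Proof.
apply/idP/eqP => [/eqP m0|->]; last by rewrite /mdeg big1 // => i _; rewrite ffunE.
by apply/ffunP => i; apply/eqP; rewrite ffunE -leqn0 -m0 leq_mdeg.
Qed.

Lemma mdeg_eq1 m : mdeg m = 1%N -> exists i, m = mvar i.
Proof.
move=> m1; have [i mi] : exists i, m i != 0%N.
  apply/existsP; rewrite -negb_forall; apply/forallP => m0.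
  by move: m1; rewrite /mdeg big1 // => i _; apply/eqP.
exists i; have im : mdvd (mvar i) m.
  by apply/mdvdP => j; rewrite ffunE; case: eqP => // ->; rewrite lt0n.
have : mdeg (msub m (mvar i)) == 0%N.
  by rewrite -(eqn_add2l (mdeg (mvar i))) -mdegD msubK // m1 mdeg_var.
by rewrite mdeg_eq0 => /eqP m0; rewrite -(msubK im) m0 addr0.
Qed.

Lemma mem_box q m : (m \in box q) = [forall i, (m i < q)%N].
Proof.
apply/fintype.imageP/forallP => [[a _ ->] i|mq]; first by rewrite ffunE.
by exists [ffun i => Ordinal (mq i)] => //; apply/ffunP => i; rewrite !ffunE.
Qed.

Lemma box_uniq q : uniq (box q).
Proof.
rewrite map_inj_uniq ?enum_uniq // => a b /ffunP ab.
by apply/ffunP => i; apply: val_inj; have := ab i; rewrite !ffunE.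
Qed.

Lemma size_box q : size (box q) = (q ^ n)%N.
Proof. by rewrite size_image card_ffun !card_ord. Qed.

Lemma mdvd_box q a m : mdvd a m -> m \in box q -> a \in box q.
Proof.
rewrite !mem_box => /mdvdP am /forallP mq.
by apply/forallP => i; apply: leq_ltn_trans (am i) (mq i).
Qed.

Lemma mdeg_box q m : m \in box q -> (mdeg m <= n * q)%N.
Proof.
rewrite mem_box => /forallP mq; rewrite -[n in (n * q)%N]card_ord -sum_nat_const.
by apply: leq_sum => i _; apply: ltnW.
Qed.

Lemma mem_box_mdeg m : m \in box (mdeg m).+1.
Proof. by rewrite mem_box; apply/forallP => i; rewrite ltnS leq_mdeg. Qed.

Lemma box_divn_eq p q m : (0 < p)%N -> m \in box (p * q) ->
  exists2 b, b \in box p & exists2 c, c \in box q & m = b + c *+ p.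
Proof.
move=> p0; rewrite mem_box => /forallP mpq.
exists [ffun i => (m i %% p)%N].
  by rewrite mem_box; apply/forallP => i; rewrite ffunE ltn_mod.
exists [ffun i => (m i %/ p)%N].
  by rewrite mem_box; apply/forallP => i; rewrite ffunE ltn_divLR // mulnC.
by apply/ffunP => i; rewrite maddE mmulnE !ffunE addnC mulnC -divn_eq.
Qed.

Lemma count_box_shift q m :
  count (fun a => a + m \in box q) (box q) = (\prod_i (q - m i))%N.
Proof.
pose A i := [pred x : 'I_q | x < q - m i]%N.
rewrite /box count_map enumT -size_filter.
transitivity #|family A|.
  rewrite cardE /enum_mem; congr (size _); apply: eq_filter => a; rewrite /= mem_box.
  apply/forallP/familyP => h i; have := h i;
    by rewrite maddE ffunE !inE ltn_subRL addnC.
rewrite card_family /image_mem foldrE big_map big_enum /=.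
apply: eq_bigr => i _; rewrite -sum1_card.
rewrite -(big_ord_widen q (fun=> 1%N) (leq_subr (m i) q)).
by rewrite sum1_card card_ord.
Qed.

End Monomials.

(** * The algebra of power series *)

Section PowerSeriesAlgebra.
Variables (k : fieldType) (n : nat).
Local Notation S := (powser k n).
Implicit Types (F G H : S) (a b m : monom n) (c : k).

Lemma sum_box_mdvd (V : nmodType) (E : monom n -> V) q m : m \in box n q ->
  \sum_(a <- box n q | mdvd a m) E a =
  \sum_(a <- box n (mdeg m).+1 | mdvd a m) E a.
Proof.
move=> mq; rewrite -big_filter -[RHS]big_filter; apply: perm_big; apply: uniq_perm.
- by rewrite filter_uniq // box_uniq.
- by rewrite filter_uniq // box_uniq.
move=> a; rewrite !mem_filter; case am: (mdvd a m) => //=.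
by rewrite (mdvd_box am mq) (mdvd_box am (mem_box_mdeg m)).
Qed.

Lemma ps_mul_box F G q m : m \in box n q ->
  ps_mul F G m = \sum_(a <- box n q | mdvd a m) F a * G (msub m a).
Proof.
move=> mq; rewrite sum_box_mdvd // /ps_mul big_map enumT big_mkcond [RHS]big_mkcond /=.
apply: eq_big => // a _; rewrite /mdvd.
have -> : [forall i, ([ffun i => nat_of_ord (a i)] i <= m i)%N] =
          [forall i, (a i <= m i)%N].
  by apply: eq_forallb => i; rewrite ffunE.
by case: ifP => // _; congr (_ * G _); apply/ffunP => i; rewrite !ffunE.
Qed.

Lemma ps_mul_sum2 F G q m : m \in box n q ->
  ps_mul F G m =
  \sum_(a <- box n q) \sum_(b <- box n q) (a + b == m)%:R * (F a * G b).
Proof.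
move=> mq; rewrite (ps_mul_box _ _ mq) big_mkcond /=; apply: eq_bigr => a _.
under eq_bigr do rewrite madd_eqE.
case: (boolP (mdvd a m)) => am /=; last by rewrite big1 // => b _; rewrite mul0r.
rewrite (bigD1_seq (msub m a)) ?box_uniq //=; last exact: mdvd_box (mdvd_msub m a) mq.
by rewrite eqxx mul1r big1 ?addr0 // => b /negbTE ->; rewrite mul0r.
Qed.

Lemma ps_mulC : commutative (@ps_mul k n).
Proof.
move=> F G; apply/funext => m; rewrite !(ps_mul_sum2 _ _ (mem_box_mdeg m)).
rewrite exchange_big; apply: eq_bigr => a _; apply: eq_bigr => b _.
by rewrite addrC [F b * _]mulrC.
Qed.

Lemma ps_mul_sum3 F G H q m : m \in box n q ->
  ps_mul F (ps_mul G H) m =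
  \sum_(a <- box n q) \sum_(b <- box n q) \sum_(c <- box n q)
     (a + b + c == m)%:R * (F a * G b * H c).
Proof.
move=> mq; rewrite (ps_mul_sum2 _ _ mq); apply: eq_bigr => a _.
have expand d : d \in box n q -> (a + d == m)%:R * (F a * ps_mul G H d) =
    \sum_(b <- box n q) \sum_(c <- box n q)
      (a + d == m)%:R * ((b + c == d)%:R * (F a * G b * H c)).
  move=> dq; rewrite (ps_mul_sum2 _ _ dq) !mulr_sumr.
  apply: eq_bigr => b _; rewrite !mulr_sumr; apply: eq_bigr => c _.
  by rewrite -!mulrA; congr (_ * _); rewrite mulrCA.
rewrite big_seq (eq_bigr _ expand) -big_seq exchange_big; apply: eq_bigr => b _.
rewrite exchange_big; apply: eq_bigr => c _ /=.
case: (boolP (a + b + c == m)) => [/eqP abcm|abcm].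
  have bcq : b + c \in box n q.
    by apply: mdvd_box mq; rewrite -abcm -addrA [a + _]addrC mdvd_add.
  rewrite (bigD1_seq (b + c)) ?box_uniq //= addrA abcm !eqxx !mul1r.
  by rewrite big1 ?addr0 // => d /negbTE; rewrite eq_sym => ->; rewrite mul0r mulr0.
rewrite mul0r big1 // => d _; case: (b + c =P d) => [<-|_]; last by rewrite mul0r mulr0.
by rewrite addrA (negbTE abcm) mul0r.
Qed.

Lemma ps_mulA : associative (@ps_mul k n).
Proof.
move=> F G H; apply/funext => m; rewrite [in RHS]ps_mulC.
rewrite !(ps_mul_sum3 _ _ _ (mem_box_mdeg m)).
rewrite [RHS]exchange_big; apply: eq_bigr => a _.
rewrite [RHS]exchange_big; apply: eq_bigr => b _; apply: eq_bigr => c _.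
by rewrite -[c + a + b]addrA [c + _]addrC -[H c * _ * _]mulrA [H c * _]mulrC.
Qed.

Definition psX a : S := fun m => (m == a)%:R.

Lemma ps_mulX a F m : ps_mul (psX a) F m = if mdvd a m then F (msub m a) else 0.
Proof.
rewrite (ps_mul_box _ _ (mem_box_mdeg m)); case: ifP => am.
  rewrite big_mkcond (bigD1_seq a) ?box_uniq ?(mdvd_box am (mem_box_mdeg m)) //=.
  rewrite am /psX eqxx mul1r big1 ?addr0 // => b /negbTE ->.
  by rewrite mul0r if_same.
rewrite big1 // => b bm; rewrite /psX; case: eqP => [ba|]; last by rewrite mul0r.
by rewrite -ba bm in am.
Qed.

Lemma ps_mul1 : left_id (@ps_one k n) (@ps_mul k n).
Proof.
by move=> F; apply/funext => m; rewrite -[@ps_one k n]/(psX 0) ps_mulX mdvd0 msubm0.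
Qed.

Lemma ps_mulDl : left_distributive (@ps_mul k n) (@ps_add k n).
Proof.
move=> F G H; apply/funext => m; rewrite /ps_add !(ps_mul_box _ _ (mem_box_mdeg m)).
by rewrite -big_split; apply: eq_bigr => a _; rewrite mulrDl.
Qed.

HB.instance Definition _ := GRing.Lmodule.copy S (monom n -> k^o)%type.

Lemma ps_one_neq0 : @ps_one k n != (0 : S).
Proof.
apply/eqP => /(congr1 (fun F : S => F 0)); rewrite /ps_one eqxx.
by move/eqP; rewrite oner_eq0.
Qed.

HB.instance Definition _ := GRing.Zmodule_isComNzRing.Build S
  ps_mulA ps_mulC ps_mul1 ps_mulDl ps_one_neq0.

Lemma psDE F G m : (F + G) m = F m + G m. Proof. by []. Qed.
Lemma psBE F G m : (F - G) m = F m - G m. Proof. by []. Qed.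
Lemma psZE c F m : (c *: F) m = c * F m. Proof. by []. Qed.
Lemma ps1E m : (1 : S) m = (m == 0)%:R. Proof. by []. Qed.

Lemma ps_sumE (I : Type) (r : seq I) (P : pred I) (E : I -> S) m :
  (\sum_(i <- r | P i) E i) m = \sum_(i <- r | P i) E i m.
Proof. by elim/big_rec2: _ => // i x y _ <-. Qed.

Lemma psME F G m :
  (F * G) m = \sum_(a <- box n (mdeg m).+1 | mdvd a m) F a * G (msub m a).
Proof. exact: ps_mul_box (mem_box_mdeg m). Qed.

Lemma ps_scaleAl c F G : c *: (F * G) = c *: F * G.
Proof.
apply/funext => m; rewrite psZE !psME mulr_sumr.
by apply: eq_bigr => a _; rewrite psZE mulrA.
Qed.

HB.instance Definition _ := GRing.Lmodule_isLalgebra.Build k S ps_scaleAl.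

Lemma ps_scaleAr c F G : c *: (F * G) = F * (c *: G).
Proof. by rewrite mulrC scalerAl mulrC. Qed.

HB.instance Definition _ := GRing.Lalgebra_isAlgebra.Build k S ps_scaleAr.

Lemma ps_powE F q : ps_pow F q = F ^+ q.
Proof. by elim: q => [|q IH]; rewrite ?exprS -?IH. Qed.

Lemma psXME a F m : (psX a * F) m = if mdvd a m then F (msub m a) else 0.
Proof. exact: ps_mulX. Qed.

Lemma psXD a b : psX (a + b) = psX a * psX b.
Proof.
apply/funext => m; rewrite psXME /psX eq_sym madd_eqE [b == _]eq_sym.
by case: mdvd.
Qed.

Lemma psXMn a q : psX (a *+ q) = psX a ^+ q.
Proof. by elim: q => // q IH; rewrite mulrS psXD IH exprS. Qed.

Definition ps_at0 F := F 0.

Lemma ps_at0_zmod_morphism : zmod_morphism ps_at0. Proof. by []. Qed.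

Lemma ps_at0_monoid_morphism : monoid_morphism ps_at0.
Proof.
split=> [|F G]; rewrite /ps_at0 ?ps1E ?eqxx // psME big_mkcond.
rewrite (bigD1_seq 0) ?box_uniq ?mem_box_mdeg //= mdvd0 msubm0.
rewrite big1 ?addr0 // => a /eqP a0; case: mdvdP => // a_le0; case: a0.
by apply/ffunP => i; apply/eqP; have := a_le0 i; rewrite ffunE leqn0.
Qed.

HB.instance Definition _ := GRing.isZmodMorphism.Build S k ps_at0 ps_at0_zmod_morphism.
HB.instance Definition _ :=
  GRing.isMonoidMorphism.Build S k ps_at0 ps_at0_monoid_morphism.

Lemma ps_at0_scalar c : ps_at0 c%:A = c.
Proof. by rewrite /ps_at0 psZE ps1E eqxx mulr1. Qed.

End PowerSeriesAlgebra.

(** * Ideals *)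

Lemma expr_sum_pchar (R : comNzSemiRingType) q (I : Type) (r : seq I) (P : pred I)
    (E : I -> R) : [pchar R].-nat q ->
  (\sum_(i <- r | P i) E i) ^+ q = \sum_(i <- r | P i) E i ^+ q.
Proof.
move=> qR; apply: (big_morph (fun y => y ^+ q)) => [y z|]; first exact: exprDn_pchar.
by rewrite expr0n gtn_eqF //; case/andP: qR.
Qed.

Section Ideals.
Variables (k : fieldType) (n : nat).
Local Notation S := (powser k n).
Local Notation x i := (psX k (mvar i)).
Implicit Types (F G H f : S) (I T : set S) (N q : nat).

Lemma is_idealE I : is_ideal I <->
  [/\ I 0, forall F G, I F -> I G -> I (F + G) & forall s F, I F -> I (s * F)].
Proof. by []. Qed.

Lemma is_idealD I F G : is_ideal I -> I F -> I G -> I (F + G).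
Proof. by case=> _ ID _; apply: ID. Qed.

Lemma is_idealM I s F : is_ideal I -> I F -> I (s * F).
Proof. by case=> _ _ IM; apply: IM. Qed.

Lemma is_idealB I F G : is_ideal I -> I F -> I G -> I (F - G).
Proof.
by move=> idI IF IG; apply: is_idealD => //; rewrite -mulN1r; apply: is_idealM.
Qed.

Lemma is_ideal_sum I (J : Type) (r : seq J) (P : pred J) (E : J -> S) :
  is_ideal I -> (forall j, P j -> I (E j)) -> I (\sum_(j <- r | P j) E j).
Proof. by move=> [I0 ID _] IE; apply: (big_ind I). Qed.

Lemma is_ideal_gen T : is_ideal (ideal_gen T).
Proof.
apply/is_idealE; split=> [I [] //|F G TF TG I idI TI|s F TF I idI TI].
  by apply: is_idealD => //; [apply: TF|apply: TG].
by apply: is_idealM => //; apply: TF.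
Qed.

Lemma sub_ideal_gen T : T `<=` ideal_gen T.
Proof. by move=> F TF I _; apply. Qed.

Lemma ideal_gen_min T I : is_ideal I -> T `<=` I -> ideal_gen T `<=` I.
Proof. by move=> idI TI F; apply. Qed.

Lemma is_ideal_maxideal : is_ideal (@maxideal k n).
Proof.
apply/is_idealE; split=> // [F G F0 G0|s F F0].
  by rewrite /maxideal /= psDE F0 G0 addr0.
by rewrite /maxideal /= -[LHS]/(ps_at0 _) rmorphM /= [ps_at0 F]F0 mulr0.
Qed.

Definition order_ge N : set S := [set F | forall m, (mdeg m < N)%N -> F m = 0].

(* The ideal generated by the q-th powers of the variables, in terms of
   coefficients; it is m^[q] when q is a power of the characteristic. *)
Definition xpow_ideal q : set S := [set F | forall m, m \in box n q -> F m = 0].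

Lemma order_geM N1 N2 F G :
  order_ge N1 F -> order_ge N2 G -> order_ge (N1 + N2) (F * G).
Proof.
move=> oF oG m mN; rewrite psME big1 // => a am.
have : (mdeg a + mdeg (msub m a) < N1 + N2)%N by rewrite -mdegD msubK.
case: (ltnP (mdeg a) N1) => [aN1 _|aN1 h]; first by rewrite oF ?mul0r.
by rewrite [G _]oG ?mulr0 //; lia.
Qed.

Lemma order_geX N F : order_ge 1 F -> order_ge N (F ^+ N).
Proof. by move=> oF; elim: N => // N IH; rewrite exprS -add1n; apply: order_geM. Qed.

Lemma is_ideal_order_ge N : is_ideal (order_ge N).
Proof.
apply/is_idealE; split=> // [F G oF oG m mN|s F oF].
  by rewrite psDE oF // oG // addr0.
by rewrite -[N]add0n; apply: order_geM.
Qed.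

Lemma order_ge1P F : order_ge 1 F <-> maxideal F.
Proof.
split=> [oF|F0 m]; first by apply: oF; rewrite ltnS leqn0 mdeg_eq0.
by rewrite ltnS leqn0 mdeg_eq0 => /eqP ->.
Qed.

Lemma maxideal_sub_at0 F : maxideal (F - (ps_at0 F)%:A).
Proof. by rewrite /maxideal /= psBE -[X in _ - X]/(ps_at0 _) ps_at0_scalar subrr. Qed.

Lemma maxideal_psX (i : 'I_n) : maxideal (x i).
Proof.
by apply/order_ge1P => m; rewrite /psX; case: eqP => // ->; rewrite mdeg_var.
Qed.

Lemma xpow_idealM q F G : xpow_ideal q G -> xpow_ideal q (F * G).
Proof.
move=> qG m mq; rewrite psME big1 // => a am.
by rewrite qG ?mulr0 //; apply: mdvd_box (mdvd_msub m a) mq.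
Qed.

Lemma is_ideal_xpow_ideal q : is_ideal (xpow_ideal q).
Proof.
apply/is_idealE; split=> // [F G qF qG m mq|s F]; last exact: xpow_idealM.
by rewrite psDE qF // qG // addr0.
Qed.

Lemma xpow_ideal_psX q a : a \notin box n q -> xpow_ideal q (psX k a).
Proof. by move=> aq m mq; rewrite /psX; case: eqP => // ma; rewrite -ma mq in aq. Qed.

Lemma order_ge_xpow_ideal q : order_ge (n * q).+1 `<=` xpow_ideal q.
Proof. by move=> F oF m mq; apply: oF; rewrite ltnS mdeg_box. Qed.

Lemma psXn_xpow_ideal q i : xpow_ideal q (x i ^+ q).
Proof.
rewrite -psXMn; apply: xpow_ideal_psX; rewrite mem_box negb_forall.
by apply/existsP; exists i; rewrite mmulnE ffunE eqxx muln1 ltnn.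
Qed.

(* Each monomial of F is attributed to the first variable whose q-th power divides it. *)
Lemma xpow_ideal_sum q F : xpow_ideal q F ->
  exists2 G : 'I_n -> S, F = \sum_i x i ^+ q * G i
    & forall N, order_ge (q + N) F -> forall i, order_ge N (G i).
Proof.
move=> qF; pose owner (m : monom n) := [pick j | (q <= m j)%N].
pose G i : S := fun m =>
  let m' := mvar i *+ q + m in if owner m' == Some i then F m' else 0.
exists G => [|N oF i m mN]; last first.
  rewrite /G; case: ifP => // _; apply: oF.
  by rewrite mdegD mdegMn mdeg_var muln1 ltn_add2l.
have summand i m : (x i ^+ q * G i) m = if owner m == Some i then F m else 0.
  rewrite -psXMn psXME; case: (boolP (mdvd _ m)) => [im|/mdvdP nim].
    by rewrite /G msubK.
  rewrite /owner; case: pickP => // j qj; case: eqP => // -[ji]; case: nim => l.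
  by rewrite mmulnE ffunE -ji; case: eqP => [->|_]; rewrite ?muln1 ?muln0.
apply/funext => m; rewrite ps_sumE; under eq_bigr do rewrite summand /owner.
case: pickP => [j _|mq]; last first.
  by rewrite big1 // qF // mem_box; apply/forallP => i; rewrite ltnNge mq.
rewrite (bigD1 j) //= eqxx big1 ?addr0 // => i ij.
by case: eqP => // -[ji]; rewrite ji eqxx in ij.
Qed.

Lemma xpow_ideal_min q I :
  is_ideal I -> (forall i, I (x i ^+ q)) -> xpow_ideal q `<=` I.
Proof.
move=> idI Ix F /xpow_ideal_sum[G -> _]; apply: is_ideal_sum => // i _.
by rewrite mulrC; apply: is_idealM.
Qed.

Lemma xpow_ideal1 : xpow_ideal 1 = @maxideal k n.
Proof.
apply/seteqP; split; last first.
  move=> F /order_ge1P oF m; rewrite mem_box => /forallP m1; apply: oF.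
  by rewrite [mdeg m]big1 // => i _; apply/eqP; rewrite -leqn0 -ltnS.
by apply: xpow_ideal_min => [|i]; [apply: is_ideal_maxideal|apply: maxideal_psX].
Qed.

Lemma order_geS_sum N F : order_ge N.+1 F ->
  exists2 G : 'I_n -> S, F = \sum_i x i * G i & forall i, order_ge N (G i).
Proof.
move=> oF; have [|G FG oG] := @xpow_ideal_sum 1 F; last by exists G => //; exact: oG.
by rewrite xpow_ideal1; apply/order_ge1P => m m1; apply: oF; apply: leq_trans m1 _.
Qed.

Lemma maxideal_sum F : maxideal F -> exists G : 'I_n -> S, F = \sum_i x i * G i.
Proof. by move=> /order_ge1P/order_geS_sum[G FG _]; exists G. Qed.

(* The geometric series of 1 - F / F(0), truncated coefficientwise. *)
Lemma ps_has_inverse F : F 0 != 0 -> exists G, G * F = 1.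
Proof.
move=> F0; pose H := 1 - (F 0)^-1 *: F.
have oH : order_ge 1 H.
  by apply/order_ge1P; rewrite /maxideal /H /= psBE psZE ps1E eqxx mulVf // subrr.
pose G : S := fun m => (\sum_(j < (mdeg m).+1) H ^+ j) m.
have G_trunc N m : (mdeg m < N)%N -> G m = (\sum_(j < N) H ^+ j) m.
  move=> mN; rewrite /G !ps_sumE -(subnKC mN) big_split_ord /=.
  rewrite [X in _ = _ + X]big1 ?addr0 // => j _.
  by apply: (order_geX oH); rewrite leq_addr.
exists ((F 0)^-1 *: G); rewrite -scalerAl scalerAr -[_ *: F](subKr 1) -/H.
apply/funext => m; set N := (mdeg m).+1.
have -> : (G * (1 - H)) m = ((\sum_(j < N) H ^+ j) * (1 - H)) m.
  rewrite !psME; apply: eq_bigr => a /mdvdP am; rewrite (G_trunc N) //.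
  by rewrite ltnS; apply: leq_sum => i _.
rewrite mulrC -[1 - H]opprB mulNr -subrX1 opprB psBE.
by rewrite (order_geX oH) ?subr0 // /N.
Qed.

Definition ps_unit : pred S := fun F => F 0 != 0.

Definition ps_inv F : S :=
  if pselect (ps_unit F) is left F0 then projT1 (cid (ps_has_inverse F0)) else F.

Lemma ps_mulVr : {in ps_unit, left_inverse 1 ps_inv *%R}.
Proof.
by move=> F F0; rewrite /ps_inv; case: pselect => [F0'|/(_ F0)//]; case: cid.
Qed.

Lemma ps_unitP F G : G * F = 1 -> ps_unit F.
Proof.
move=> /(congr1 (@ps_at0 k n)); rewrite rmorphM rmorph1 /= => GF.
by apply: contra_eq_neq GF => F0; rewrite /ps_at0 F0 mulr0 eq_sym oner_eq0.
Qed.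

Lemma ps_inv_out : {in [predC ps_unit], ps_inv =1 id}.
Proof.
by move=> F /negP F_nunit; rewrite /ps_inv; case: pselect.
Qed.

HB.instance Definition _ := GRing.ComNzRing_hasMulInverse.Build S
  ps_mulVr ps_unitP ps_inv_out.

Lemma ps_unitE F : (F \is a GRing.unit) = (F 0 != 0). Proof. by []. Qed.

Section Frobenius.
Variable p : nat.
Hypothesis pchar_p : [pchar k].-nat p.

Lemma ps_pchar : [pchar S].-nat p.
Proof. by rewrite (eq_pnat _ (pchar_lalg _)). Qed.

Lemma xpow_ideal_frob q F : xpow_ideal q F -> xpow_ideal (p * q) (F ^+ p).
Proof.
move=> /xpow_ideal_sum[G -> _]; rewrite expr_sum_pchar ?ps_pchar //.
apply: is_ideal_sum => [|i _]; first exact: is_ideal_xpow_ideal.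
by rewrite exprMn -exprM mulrC mulnC; apply/xpow_idealM/psXn_xpow_ideal.
Qed.

Lemma maxideal_frob F : maxideal F -> xpow_ideal p (F ^+ p).
Proof.
by move=> mF; rewrite -{1}[p]muln1; apply: xpow_ideal_frob; rewrite xpow_ideal1.
Qed.

End Frobenius.

End Ideals.

(** * Truncation modulo the q-th powers of the variables *)

Lemma mxrank_adds_row (k : fieldType) r m (U : 'M[k]_(r, m)) (v : 'rV[k]_m) :
  ~~ (v <= U)%MS -> \rank (U + v)%MS = (\rank U).+1.
Proof.
move=> vU; apply/eqP; rewrite eqn_leq; apply/andP; split.
  apply: leq_trans (mxrank_adds_leqif U v) _.
  by rewrite -[X in (_ <= X)%N]addn1 leq_add2l rank_leq_row.
apply: rank_ltmx; rewrite ltmxE addsmxSl; apply: contra vU.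
by apply: submx_trans; apply: addsmxSr.
Qed.

Lemma sub_adds_rowP (k : fieldType) r m (U : 'M[k]_(r, m)) (u v : 'rV[k]_m) :
  (u <= U + v)%MS <-> exists c, (u - c *: v <= U)%MS.
Proof.
split=> [/sub_addsmxP[[w c] /= ->]|[c uU]].
  by exists (c 0 0); rewrite [c]mx11_scalar mul_scalar_mx !mxE mulr1n addrK submxMl.
by rewrite -(subrK (c *: v) u) addmx_sub_adds // scalemx_sub.
Qed.

Lemma linear_set_rowspace (k : fieldType) m (P : set 'rV[k]_m) :
  P 0 -> (forall u v, P u -> P v -> P (u + v)) -> (forall c u, P u -> P (c *: u)) ->
  exists U : 'M[k]_m, forall v, P v <-> (v <= U)%MS.
Proof.
move=> P0 PD PZ.
pose spans (U : 'M[k]_m) := forall v, (v <= U)%MS -> P v.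
have [|U PU Umax] := @exists_argmin_nat _ spans (fun U => m - \rank U)%N.
  by exists 0 => v /submx0null ->.
exists U => v; split=> [Pv|]; last exact: PU.
apply/negPn/negP => vU; have PUv : spans (U + v)%MS.
  move=> w /sub_adds_rowP[c /PU Pwcv].
  by rewrite -(subrK (c *: v) w); apply: PD => //; apply: PZ.
have := Umax _ PUv; have := rank_leq_row (U + v)%MS.
by rewrite mxrank_adds_row //; lia.
Qed.

Section Truncation.
Variables (k : fieldType) (n q : nat).
Local Notation S := (powser k n).
Local Notation D := (size (box n q)).
Implicit Types F G f : S.

Definition box_monom (i : 'I_D) : monom n := nth 0 (box n q) i.

Definition trunc_row F : 'rV[k]_D := \row_j F (box_monom j).

(* Multiplication by f on S / xpow_ideal q, acting on row vectors. *)
Definition mulop f : 'M[k]_D := \matrix_i trunc_row (psX k (box_monom i) * f).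

Lemma mem_box_monom i : box_monom i \in box n q.
Proof. exact: mem_nth. Qed.

Lemma box_monom_inj : injective box_monom.
Proof.
move=> i j /eqP; rewrite nth_uniq ?box_uniq ?ltn_ord // => /eqP.
exact: val_inj.
Qed.

Lemma box_monomP a : a \in box n q -> exists i, box_monom i = a.
Proof. by move=> /(nthP 0)[i iD <-]; exists (Ordinal iD). Qed.

Lemma trunc_row_is_linear : linear trunc_row.
Proof. by move=> c F G; apply/rowP => j; rewrite !mxE. Qed.

HB.instance Definition _ :=
  GRing.isLinear.Build k S 'rV[k]_D _ trunc_row trunc_row_is_linear.

Lemma trunc_row_eq0P F : trunc_row F = 0 <-> xpow_ideal q F.
Proof.
split=> [/rowP F0 m /box_monomP[i <-]|qF]; first by have := F0 i; rewrite !mxE.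
by apply/rowP => j; rewrite !mxE qF // mem_box_monom.
Qed.

Lemma trunc_row_eqP F G : trunc_row F = trunc_row G <-> xpow_ideal q (F - G).
Proof.
rewrite -trunc_row_eq0P linearB /=; split=> [->|/eqP]; first by rewrite subrr.
by rewrite subr_eq0 => /eqP.
Qed.

Lemma trunc_row_psX i : trunc_row (psX k (box_monom i)) = delta_mx 0 i.
Proof. by apply/rowP => j; rewrite !mxE /psX (inj_eq box_monom_inj) eqxx. Qed.

Definition row_series (u : 'rV[k]_D) : S := \sum_i u 0 i *: psX k (box_monom i).

Lemma row_seriesK : cancel row_series trunc_row.
Proof.
move=> u; rewrite linear_sum [RHS]row_sum_delta; apply: eq_bigr => i _.
by rewrite linearZ /= trunc_row_psX.
Qed.

Lemma trunc_rowM F f : trunc_row (F * f) = trunc_row F *m mulop f.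
Proof.
have -> : trunc_row (F * f) = trunc_row (row_series (trunc_row F) * f).
  apply/trunc_row_eqP; rewrite -mulrBl mulrC; apply: xpow_idealM.
  by apply/trunc_row_eqP; rewrite row_seriesK.
rewrite mulr_suml linear_sum mulmx_sum_row; apply: eq_bigr => i _.
by rewrite -scalerAl linearZ /= rowK.
Qed.

Lemma mulopM f g : mulop (f * g) = mulop f *m mulop g.
Proof. by apply/row_matrixP => i; rewrite row_mul !rowK mulrA trunc_rowM. Qed.

Lemma mulop1 : mulop 1 = 1%:M.
Proof. by apply/row_matrixP => i; rewrite rowK row1 mulr1 trunc_row_psX. Qed.

Lemma mulop_is_linear : linear mulop.
Proof.
move=> c f g; apply/row_matrixP => i.
by rewrite linearP /= !rowK mulrDr -scalerAr linearP.
Qed.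

HB.instance Definition _ := GRing.isLinear.Build k S 'M[k]_D _ mulop mulop_is_linear.

Lemma eq_mulop f g : xpow_ideal q (f - g) -> mulop f = mulop g.
Proof.
move=> fg; apply/row_matrixP => i; rewrite !rowK; apply/trunc_row_eqP.
by rewrite -mulrBr; apply: xpow_idealM.
Qed.

Definition trunc_preim m (U : 'M[k]_(m, D)) : set S := [set F | (trunc_row F <= U)%MS].

Lemma trunc_preim_subsetP m1 m2 (U : 'M[k]_(m1, D)) (V : 'M[k]_(m2, D)) :
  trunc_preim U `<=` trunc_preim V <-> (U <= V)%MS.
Proof.
split=> [UV|UV F]; last by move=> /submx_trans; apply.
apply/row_subP => i; rewrite -(row_seriesK (row i U)); apply: UV.
by rewrite /trunc_preim /= row_seriesK row_sub.
Qed.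

Lemma is_ideal_trunc_preimP m (U : 'M[k]_(m, D)) :
  is_ideal (trunc_preim U) <-> forall s, (U *m mulop s <= U)%MS.
Proof.
split=> [idU s|UM].
  apply/row_subP => i; rewrite row_mul -(row_seriesK (row i U)) -trunc_rowM mulrC.
  by apply: (is_idealM s idU); rewrite /trunc_preim /= row_seriesK row_sub.
apply/is_idealE; rewrite /trunc_preim /=.
split=> [|F G FU GU|s F FU]; first by rewrite linear0 sub0mx.
  by rewrite linearD addmx_sub.
by rewrite mulrC trunc_rowM (submx_trans (submxMr _ FU)).
Qed.

Lemma xpow_ideal_trunc_preim m (U : 'M[k]_(m, D)) : xpow_ideal q `<=` trunc_preim U.
Proof. by move=> F /trunc_row_eq0P F0; rewrite /trunc_preim /= F0 sub0mx. Qed.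

Lemma ideal_eq_trunc_preim (J : set S) : is_ideal J -> xpow_ideal q `<=` J ->
  exists U : 'M[k]_D, J = trunc_preim U.
Proof.
move=> idJ qJ; have [J0 _ _] := idJ.
have [|u v|c u|U HU] := @linear_set_rowspace _ D [set trunc_row F | F in J].
- by exists 0 => //; rewrite linear0.
- by move=> [F JF <-] [G JG <-]; exists (F + G); [exact: is_idealD|rewrite linearD].
- by move=> [F JF <-]; exists (c%:A * F); [exact: is_idealM|rewrite mulr_algl linearZ].
exists U; apply/seteqP; split=> F; first by move=> JF; apply/HU; exists F.
move=> /HU[G JG /esym/trunc_row_eqP FG].
by rewrite -(subrK G F); apply: is_idealD => //; apply: qJ.
Qed.

Lemma frob_idealE f : [pchar k].-nat q -> frob_ideal f q = trunc_preim (mulop f).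
Proof.
move=> pchar_q; apply/seteqP; split=> [|F /submxP[v Fv]].
  apply: ideal_gen_min => [|F [->|[a am <-]]].
  - by apply/is_ideal_trunc_preimP => s; rewrite -mulopM mulrC mulopM submxMl.
  - by rewrite /trunc_preim /= -[f]mul1r trunc_rowM mul1r submxMl.
  - by apply: xpow_ideal_trunc_preim; rewrite ps_powE; apply: maxideal_frob.
have idf : is_ideal (frob_ideal f q) by apply: is_ideal_gen.
rewrite -(subrK (row_series v * f) F); apply: (is_idealD idf); last first.
  by apply: (is_idealM _ idf); apply: sub_ideal_gen; left.
apply: (xpow_ideal_min (q := q)) => // [i|].
  apply: sub_ideal_gen; right; exists (psX k (mvar i)); last by rewrite ps_powE.
  exact: maxideal_psX.
by apply/trunc_row_eqP; rewrite trunc_rowM row_seriesK.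
Qed.

End Truncation.

(** * Length as a corank *)

Section Chains.
Variables (k : fieldType) (n : nat).
Implicit Types J : set (powser k n).

Lemma has_chain0 : has_chain (@setT (powser k n)) 0.
Proof. by exists (fun=> setT). Qed.

Lemma has_chainS J J' N :
  is_ideal J -> J `<` J' -> has_chain J' N -> has_chain J N.+1.
Proof.
move=> idJ JJ' [c [c0 cN cI clt]].
exists (fun j => if j is j'.+1 then c j' else J).
by split=> // [[|j]|[|j]] // jN; [exact: cI|rewrite c0|exact: clt].
Qed.

Lemma qlength_max_chain (R : realType) J N :
  has_chain J N -> (forall M, has_chain J M -> (M <= N)%N) -> qlength R J = N%:R.
Proof.
move=> JN Jmax; rewrite /qlength; set A := [set _ | _ in _].
have AN : A N%:R by exists N.
have ubA : ubound A N%:R by move=> _ [M JM <-]; rewrite ler_nat Jmax.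
by apply/eqP; rewrite eq_le ge_sup ?ub_le_sup //; exists N%:R.
Qed.

End Chains.

Section Corank.
Variables (k : fieldType) (n q : nat).
Local Notation S := (powser k n).
Local Notation D := (size (box n q)).
Implicit Types U : 'M[k]_D.

Lemma has_chain_trunc_preim_leq U N :
  has_chain (trunc_preim U) N -> (N + \rank U <= D)%N.
Proof.
move=> [c [c0 cN cI clt]].
have qc i : (i <= N)%N -> xpow_ideal q `<=` c i.
  elim: i => [_|i IH iN]; first by rewrite c0; apply: xpow_ideal_trunc_preim.
  by apply: subset_trans (IH (ltnW iN)) _; apply: properW; apply: clt.
have cE i : (i <= N)%N -> exists V : 'M[k]_D, c i = trunc_preim V.
  by move=> iN; apply: ideal_eq_trunc_preim; [apply: cI|apply: qc].
suff rank_c i (V : 'M[k]_D) :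
    (i <= N)%N -> c i = trunc_preim V -> (i + \rank U <= \rank V)%N.
  have [V cV] := cE N (leqnn N).
  exact: leq_trans (rank_c N V (leqnn N) cV) (rank_leq_row V).
elim: i V => [|i IH] V iN cV.
  by apply: mxrankS; apply/trunc_preim_subsetP; rewrite -c0 cV.
have [W cW] := cE i (ltnW iN).
rewrite addSn; apply: leq_ltn_trans (IH W (ltnW iN) cW) _.
have [WV VW] := clt i iN; rewrite cW cV in WV VW.
apply: rank_ltmx; rewrite ltmxE; apply/andP; split; first exact/trunc_preim_subsetP.
by apply/negP => /trunc_preim_subsetP.
Qed.

Lemma is_ideal_adds_socle U (G : S) : is_ideal (trunc_preim U) ->
  (forall i, trunc_preim U (psX k (mvar i) * G)) ->
  is_ideal (trunc_preim (U + trunc_row q G)%MS).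
Proof.
move=> idU GU; apply/is_ideal_trunc_preimP => s; rewrite addsmxMr addsmx_sub.
have UU := addsmxSl U (trunc_row q G).
have /is_ideal_trunc_preimP/(_ s) Us := idU; rewrite (submx_trans Us UU) /=.
rewrite -trunc_rowM mulrC; apply/sub_adds_rowP; exists (ps_at0 s).
have -> : trunc_row q (s * G) - ps_at0 s *: trunc_row q G =
    trunc_row q ((s - (ps_at0 s)%:A) * G).
  by rewrite mulrBl mulr_algl raddfB /= [in RHS]linearZ.
have [H ->] := maxideal_sum (maxideal_sub_at0 s).
rewrite mulr_suml; apply: (is_ideal_sum (I := trunc_preim U)) => // i _.
by rewrite mulrAC mulrC; apply: (is_idealM (H i) idU).
Qed.

Lemma exists_socle_monom U : is_ideal (trunc_preim U) -> (\rank U < D)%N ->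
  exists2 a, ~ trunc_preim U (psX k a) & forall i, trunc_preim U (psX k (mvar i + a)).
Proof.
move=> idU ltUD.
pose outside (i : 'I_D) := ~~ (trunc_row q (psX k (box_monom i)) <= U)%MS.
have [i0 Ui0] : exists i, outside i.
  apply/existsP; rewrite -negb_forall; apply: contraL ltUD => /forallP UX.
  rewrite -leqNgt -{1}(mxrank1 k D); apply: mxrankS; apply/row_subP => i.
  by rewrite row1 -trunc_row_psX.
case: (arg_maxnP (fun i => mdeg (box_monom i)) Ui0) => i /negP Ui imax.
exists (box_monom i) => // l; rewrite /trunc_preim /=.
have [/box_monomP[j ji]|off] := boolP (mvar l + box_monom i \in box n q); last first.
  by apply: xpow_ideal_trunc_preim; apply: xpow_ideal_psX.
by rewrite -ji; apply/negPn/negP => /imax; rewrite /= ji mdegD mdeg_var; lia.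
Qed.

Lemma has_chain_trunc_preim U :
  is_ideal (trunc_preim U) -> has_chain (trunc_preim U) (D - \rank U).
Proof.
move: {-1}(D - _)%N (erefl (D - \rank U)%N) => r.
elim: r U => [|r IH] U rU idU.
  suff -> : trunc_preim U = setT by apply: has_chain0.
  apply/seteqP; split=> // F _; apply: submx_full.
  by rewrite /row_full eqn_leq rank_leq_row -subn_eq0 rU.
have [a Ua socle_a] : exists2 a, ~ trunc_preim U (psX k a)
    & forall i, trunc_preim U (psX k (mvar i + a)).
  by apply: exists_socle_monom => //; rewrite -subn_gt0 rU.
set V := (U + trunc_row q (psX k a))%MS.
have UV : trunc_preim U `<` trunc_preim V.
  split; first by apply/trunc_preim_subsetP; apply: addsmxSl.
  by move/(_ (psX k a))/(_ (addsmxSr _ _)).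
apply: has_chainS UV _ => //; apply: IH.
  by rewrite mxrank_adds_row ?subnS ?rU //; apply/negP.
by apply: is_ideal_adds_socle => // i; rewrite -psXD.
Qed.

Lemma qlength_trunc_preim (R : realType) U :
  is_ideal (trunc_preim U) -> qlength R (trunc_preim U) = (D - \rank U)%:R.
Proof.
move=> idU; apply: qlength_max_chain; first exact: has_chain_trunc_preim.
by move=> M /has_chain_trunc_preim_leq; lia.
Qed.

End Corank.

Section Colength.
Variables (k : fieldType) (n : nat).
Implicit Types (f g : powser k n) (q e : nat).

Definition colength q f := (q ^ n - \rank (mulop q f))%N.

Lemma qlength_frob_ideal (R : realType) q f : [pchar k].-nat q ->
  qlength R (frob_ideal f q) = (colength q f)%:R.
Proof.
move=> pchar_q; have idf : is_ideal (frob_ideal f q) by apply: is_ideal_gen.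
rewrite frob_idealE // in idf *; rewrite qlength_trunc_preim //.
by rewrite /colength -size_box.
Qed.

Lemma colengthK q f : (colength q f + \rank (mulop q f) = q ^ n)%N.
Proof. by rewrite /colength subnK // -size_box rank_leq_row. Qed.

Lemma colengthM q f g : (colength q (f * g)%R <= colength q f + colength q g)%N.
Proof.
have := mxrank_mul_min (mulop q f) (mulop q g); rewrite -mulopM.
have := colengthK q f; have := colengthK q g; have := colengthK q (f * g).
by have := size_box n q; lia.
Qed.

Lemma colengthX q f e : (colength q (f ^+ e) <= e * colength q f)%N.
Proof.
elim: e => [|e IH]; first by rewrite expr0 /colength mulop1 mxrank1 -size_box subnn.
by rewrite exprS mulSn; apply: leq_trans (colengthM _ _ _) _; rewrite leq_add2l.
Qed.

End Colength.

(** * Frobenius and the colength *)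

Section FrobeniusColength.
Variables (k : fieldType) (n p q : nat).
Local Notation S := (powser k n).
Implicit Types F G f : S.
Hypothesis pchar_p : [pchar k].-nat p.

Definition frob_rows r G (U : 'M[k]_(r, size (box n q))) :
    'M[k]_(r, size (box n (p * q))) :=
  \matrix_l trunc_row (p * q) (G * row_series (row l U) ^+ p).

Lemma trunc_row_frob_sub r F G (U : 'M[k]_(r, size (box n q))) :
  (trunc_row q F <= U)%MS -> (trunc_row (p * q) (G * F ^+ p)%R <= frob_rows G U)%MS.
Proof.
move=> /submxP[v Fv]; pose F' := \sum_l v 0 l *: row_series (row l U).
have FF' : xpow_ideal q (F - F').
  apply/trunc_row_eqP; rewrite Fv linear_sum mulmx_sum_row.
  by apply: eq_bigr => l _; rewrite linearZ /= row_seriesK.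
have -> : trunc_row (p * q) (G * F ^+ p) = trunc_row (p * q) (G * F' ^+ p).
  apply/trunc_row_eqP; rewrite -mulrBr; apply: xpow_idealM.
  rewrite -[F](subrK F') (exprDn_pchar _ _ (ps_pchar n pchar_p)) addrK.
  exact: xpow_ideal_frob.
rewrite expr_sum_pchar ?ps_pchar // mulr_sumr linear_sum summx_sub // => l _.
rewrite exprZn -scalerAr linearZ /= scalemx_sub //.
by rewrite -(rowK (fun l => trunc_row (p * q) (G * row_series (row l U) ^+ p))) row_sub.
Qed.

Lemma rank_mulop_frob f :
  (\rank (mulop (p * q) (f ^+ p)) <= p ^ n * \rank (mulop q f))%N.
Proof.
have p0 : (0 < p)%N by case/andP: pchar_p.
pose U := row_base (mulop q f).
pose W (j : 'I_(size (box n p))) := (<<frob_rows (psX k (box_monom j)) U>>)%MS.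
have W_rank : (\rank (\sum_j W j)%MS <= p ^ n * \rank (mulop q f))%N.
  apply: leq_trans (mxrank_sum_leqif _) _; rewrite /= -size_box.
  rewrite -[X in (_ <= X * _)%N]card_ord -sum_nat_const; apply: leq_sum => j _.
  by rewrite genmxE rank_leq_row.
apply: leq_trans W_rank; apply: mxrankS; apply/row_subP => i; rewrite rowK.
have [b /box_monomP[j <-] [c /box_monomP[i' <-] ->]] := box_divn_eq p0 (mem_box_monom i).
rewrite psXD psXMn -mulrA -exprMn (sumsmx_sup j) // genmxE.
apply: trunc_row_frob_sub; rewrite eq_row_base.
by rewrite -(rowK (fun i => trunc_row q (psX k (box_monom i) * f))) row_sub.
Qed.

Lemma colength_frob f : (p ^ n * colength q f <= p * colength (p * q) f)%N.
Proof.
apply: leq_trans (colengthX (p * q) f p).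
have := rank_mulop_frob f; have := colengthK q f; have := colengthK (p * q) (f ^+ p).
by rewrite expnMn => eq_pq eq_q rank_le; rewrite -eq_q mulnDr in eq_pq; lia.
Qed.

End FrobeniusColength.

(** * Linear growth of the colength along the initial monomial *)

Lemma row_free_pivots (k : fieldType) r N (A : 'M[k]_(r, N)) (g : 'I_r -> 'I_N)
    (w : 'I_r -> nat) :
  (forall i, A i (g i) != 0) ->
  (forall i j, j != i -> (w i <= w j)%N -> A j (g i) = 0) -> row_free A.
Proof.
move=> Ag Aw; apply: inj_row_free => v vA; apply/eqP/negPn/negP => /rV0Pn[i0 vi0].
case: (@arg_minnP _ i0 (fun i => v 0 i != 0) w vi0) => i vi imin.
have /eqP := congr1 (fun u : 'rV_N => u 0 (g i)) vA.
rewrite !mxE (bigD1 i) //= big1 => [|j ji].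
  by rewrite addr0 mulf_eq0 (negbTE vi) (negbTE (Ag i)).
have [->|vj] := eqVneq (v 0 j) 0; first by rewrite mul0r.
by rewrite Aw ?mulr0 //; apply: imin.
Qed.

Lemma base_digits_inj n K (a b : 'I_n -> nat) :
  (forall i, a i < K)%N -> (forall i, b i < K)%N ->
  (\sum_i a i * K ^ i = \sum_i b i * K ^ i)%N -> a =1 b.
Proof.
elim: n a b => [|n IH] a b aK bK; first by move=> _ [].
have split_digit (c : 'I_n.+1 -> nat) : (\sum_i c i * K ^ i =
    (\sum_(i < n) c (lift ord0 i) * K ^ i) * K + c ord0)%N.
  rewrite big_ord_recl muln1 addnC big_distrl; congr (_ + _)%N.
  by apply: eq_bigr => i _; rewrite /= /bump add1n expnSr mulnA.
rewrite !split_digit => ab; have ab0 : a ord0 = b ord0.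
  by move: (congr1 (modn^~ K) ab); rewrite !modnMDl !modn_small.
move: ab; rewrite ab0 => /addIn /eqP; rewrite eqn_pmul2r; last first.
  exact: leq_ltn_trans (aK ord0).
by move=> /eqP /IH eq_ab i; case: (unliftP ord0 i) => [j ->|->] //; apply: eq_ab.
Qed.

(* Weierstrass' product inequality for q^n prod (1 - c_i / q), cleared of denominators. *)
Lemma leq_prod_subn n q (c : 'I_n -> nat) :
  (q * q ^ n <= q * \prod_i (q - c i) + (\sum_i c i) * q ^ n)%N.
Proof.
elim: n c => [|n IH] c; first by rewrite !big_ord0 mul0n addn0 expn0.
rewrite !big_ord_recl /=; set P := (\prod_(i < n) _)%N; set s := (\sum_(i < n) _)%N.
have := IH (fun i => c (lift ord0 i)); rewrite -/P -/s => IHc.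
have Pq : (P <= q ^ n)%N.
  have <- : (\prod_(i < n) q = q ^ n)%N by rewrite prod_nat_const card_ord.
  by apply: leq_prod => i _; exact: leq_subr.
rewrite expnS; set Q := (q ^ n)%N in IHc Pq *.
have : (q * P <= q * Q)%N by rewrite leq_mul2l Pq orbT.
by move: (c ord0) => x; nia.
Qed.

Section InitialMonomial.
Variables (k : fieldType) (n : nat).
Local Notation S := (powser k n).
Implicit Types (f : S) (w : 'I_n -> nat) (a b m : monom n).

Definition mweight w m := (\sum_i w i * m i)%N.

Definition initial_monom w f m0 :=
  f m0 != 0 /\ forall m, f m != 0 -> m != m0 -> (mweight w m0 < mweight w m)%N.

Lemma mweightD w a b : mweight w (a + b) = (mweight w a + mweight w b)%N.
Proof. by rewrite /mweight -big_split; apply: eq_bigr => i _; rewrite maddE mulnDr. Qed.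

(* Minimize the degree t first, then the number with digits m_i in base t + 1:
   the weight E + (t + 1)^i, with E large, orders monomials in this way. *)
Lemma exists_initial_monom f : f != 0 -> exists w m0, initial_monom w f m0.
Proof.
move=> f0; have supp_f : [set m | f m != 0] !=set0.
  apply: contrapT => /forallNP f_eq0; case/eqP: f0; apply/funext => m.
  by apply/eqP/negPn/negP/f_eq0.
have [m1 fm1 mdeg_min] := exists_argmin_nat (@mdeg n) supp_f.
set t := mdeg m1 in mdeg_min; pose digits m := (\sum_i m i * t.+1 ^ i)%N.
have [|m0 [fm0 m0t] digits_min] :=
  @exists_argmin_nat _ [set m | f m != 0 /\ mdeg m = t] digits; first by exists m1.
pose E := (digits m0).+1; pose w (i : 'I_n) := (E + t.+1 ^ i)%N.
have wE m : mweight w m = (E * mdeg m + digits m)%N.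
  rewrite /mweight /mdeg big_distrr -big_split; apply: eq_bigr => i _ /=.
  by rewrite mulnDl [(_ ^ i * _)%N]mulnC.
exists w, m0; split=> // m fm mm0; rewrite !wE m0t.
case: (ltngtP t (mdeg m)) (mdeg_min m fm) => // [ltm _|mt _].
  by apply: (@leq_trans (E * t.+1)%N); [rewrite mulnS /E; lia|nia].
rewrite -mt ltn_add2l ltn_neqAle digits_min ?andbT //.
apply: contra mm0 => /eqP eq_digits; apply/eqP/ffunP.
apply: (@base_digits_inj _ t.+1) (esym eq_digits) => i; rewrite ltnS.
- by rewrite mt leq_mdeg.
- by rewrite -m0t leq_mdeg.
Qed.

Lemma leq_rank_mulop_initial q w f m0 : initial_monom w f m0 ->
  (\prod_i (q - m0 i) <= \rank (mulop q f))%N.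
Proof.
move=> [fm0 m0_min]; rewrite -count_box_shift.
pose A : pred 'I_(size (box n q)) := [pred i | box_monom i + m0 \in box n q].
have -> : count (fun a => a + m0 \in box n q) (box n q) = #|A|.
  by rewrite -sum1_count (big_nth 0) big_mkord sum1_card.
pose a (l : 'I_#|A|) := box_monom (enum_val l).
have /choice[g gE] l : exists j : 'I_(size (box n q)), box_monom j = a l + m0.
  exact: box_monomP (enum_valP l).
suff /eqP <- : row_free (rowsub (fun l : 'I_#|A| => enum_val l) (mulop q f)).
  by apply: mxrankS; apply/row_subP => l; rewrite row_rowsub row_sub.
apply: (row_free_pivots (g := g) (w := fun l => mweight w (a l))) => [l|l l' l'l].
  by rewrite !mxE gE psXME mdvd_add maddK.
rewrite !mxE gE psXME -/(a l'); case: ifP => // a'_dvd.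
set m := msub _ _; have a'm : a l' + m = a l + m0 by apply: msubK.
apply: contraTeq => /m0_min m_gt; rewrite -ltnNge; have /m_gt : m != m0.
  apply: contra_neq l'l => mm0; apply/enum_val_inj/box_monom_inj.
  by apply: (@madd_inj _ m0); rewrite !(addrC m0) -/(a l) -a'm mm0.
by have := congr1 (mweight w) a'm; rewrite !mweightD; lia.
Qed.

End InitialMonomial.

Lemma colength_bounded (k : fieldType) d (f : powser k d.+1) : f != 0 ->
  exists C, forall q, (0 < q)%N -> (colength q f <= C * q ^ d)%N.
Proof.
move=> /exists_initial_monom[w [m0 f_m0]]; exists (mdeg m0) => q q0.
have := leq_rank_mulop_initial q f_m0; rewrite -(leq_pmul2l q0) => rank_ge.
have := leq_prod_subn q m0; rewrite -/(mdeg m0) -(colengthK q f) mulnDr colengthK expnS.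
by rewrite mulnCA => prod_ge; rewrite -(leq_pmul2l q0); lia.
Qed.

(** * Square roots of symmetric matrices *)

Lemma closed_quadratic_root (k : closedFieldType) (a b c : k) :
  2%:R != 0 :> k -> b ^+ 2 != a * c -> exists z, a * z ^+ 2 + 2%:R * b * z + c = 0.
Proof.
move=> k2 disc; pose Q : {poly k} := a *: 'X^2 + (2%:R * b) *: 'X + c%:P.
have /closed_rootP[z /eqP Qz] : size Q != 1%N.
  apply: contra disc => /size_poly1P[e _ Qe].
  have := congr1 (coefp 2) Qe; have := congr1 (coefp 1) Qe.
  rewrite /= !coefE /= !(mulr0, mulr1, addr0, add0r) => /eqP.
  by rewrite mulf_eq0 (negbTE k2) => /eqP -> ->; rewrite expr0n mul0r.
by exists z; rewrite -Qz !hornerE.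
Qed.

(* Induction on the roots of g: if s^2 = P modulo g, then s + c g is a square root
   of P modulo g (X - z) as soon as c solves a quadratic equation, whose
   discriminant is P(z) up to a factor 4. *)
Lemma poly_sqrt_mod (k : closedFieldType) (P g : {poly k}) :
  2%:R != 0 :> k -> g != 0 -> coprimep P g -> exists s, g %| s ^+ 2 - P.
Proof.
move=> k2 g0; have [rs gE] := closed_field_poly_normal g.
rewrite gE coprimepZr ?lead_coef_eq0 // => coprime_rs.
under eq_exists => s do rewrite dvdpZl ?lead_coef_eq0 //.
elim: rs {gE} coprime_rs => [|z rs IH]; first by exists 0; rewrite big_nil dvd1p.
rewrite big_cons coprimepMr coprimep_XsubC => /andP[Pz /IH[s]].
set h := \prod_(_ <- rs) _ => /dvdpP[r rE].
have [|c cz] := @closed_quadratic_root k h.[z] s.[z] r.[z] k2.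
  rewrite -subr_eq0; apply: contra Pz => /eqP sz; rewrite /root -sz mulrC -hornerM -rE.
  by rewrite !hornerE; apply/eqP; ring.
exists (s + c *: h).
have -> : (s + c *: h) ^+ 2 - P = (c ^+ 2 *: h + (2%:R * c) *: s + r) * h.
  have -> : (s + c *: h) ^+ 2 - P = s ^+ 2 - P + (2%:R * c%:P * s + c%:P ^+ 2 * h) * h.
    by rewrite -mul_polyC; ring.
  by rewrite rE -!mul_polyC !polyCM polyC_natr; ring.
apply: dvdp_mul => //; rewrite dvdp_XsubCl /root !hornerE -cz; apply/eqP; ring.
Qed.

Lemma trmx_horner_mx (R : comNzRingType) d (A : 'M[R]_d.+1) (p : {poly R}) :
  (horner_mx A p)^T = horner_mx A^T p.
Proof.
elim/poly_ind: p => [|p c IH]; first by rewrite !rmorph0 trmx0.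
rewrite !rmorphD linearD /= !horner_mx_C tr_scalar_mx; congr (_ + _).
rewrite [in RHS]mulrC !rmorphM /= !horner_mx_X -[in LHS]/(_ *m _).
by rewrite trmx_mul IH.
Qed.

Section SeriesMatrices.
Variables (k : fieldType) (n : nat).
Local Notation S := (powser k n).

Definition mx_order_ge d N (A : 'M[S]_d) := forall i j, order_ge N (A i j).

Lemma mx_order_geM d N1 N2 (A B : 'M[S]_d) :
  mx_order_ge N1 A -> mx_order_ge N2 B -> mx_order_ge (N1 + N2) (A *m B).
Proof.
move=> oA oB i j; rewrite mxE.
by apply: is_ideal_sum => [|l _]; [apply: is_ideal_order_ge|apply: order_geM].
Qed.

Lemma mx_order_geX d N (A : 'M[S]_d.+1) : mx_order_ge 1 A -> mx_order_ge N (A ^+ N).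
Proof.
by move=> oA; elim: N => // N IH; rewrite exprS -[N.+1]add1n; apply: mx_order_geM.
Qed.

Lemma mx_order_ge1P d (A : 'M[S]_d) : mx_order_ge 1 A <-> map_mx (@ps_at0 k n) A = 0.
Proof.
split=> [oA|/matrixP A0 i j]; last by apply/order_ge1P; have := A0 i j; rewrite !mxE.
by apply/matrixP => i j; rewrite !mxE; apply/order_ge1P.
Qed.

Lemma unitmx_at0 d (A : 'M[S]_d) : (A \in unitmx) = (map_mx (@ps_at0 k n) A \in unitmx).
Proof. by rewrite !unitmxE det_map_mx ps_unitE unitfE. Qed.

End SeriesMatrices.

Lemma unitmx_sub_scalar (F : fieldType) d (A : 'M[F]_d) s :
  (A - s%:M \in unitmx) = ~~ root (char_poly A) s.
Proof.
by rewrite -eigenvalue_root_char /eigenvalue kermx_eq0 negbK row_free_unit.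
Qed.

(* Modulo a power of m the root is a polynomial in C, hence symmetric, because
   chi(C) has entries in m for the characteristic polynomial chi of C(0), and X
   is prime to chi. *)
Lemma sym_mx_sqrt (k : closedFieldType) n d (C : 'M[powser k n]_d.+1) N :
  2%:R != 0 :> k -> C^T = C -> C \in unitmx ->
  exists2 P : 'M[powser k n]_d.+1, P^T = P & mx_order_ge N (P *m P - C).
Proof.
move=> k2 CT; rewrite unitmx_at0; set A := map_mx _ C => A_unit; pose chi := char_poly A.
have [||s] := @poly_sqrt_mod k 'X (chi ^+ N) k2.
- by rewrite expf_neq0 // monic_neq0 // char_poly_monic.
- rewrite coprimep_expr // coprimep_sym -['X]subr0 -[0]/(0%:P) coprimep_XsubC.
  by rewrite -unitmx_sub_scalar raddf0 subr0.
move=> /dvdpP[h sE].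
pose ev : {rmorphism {poly k} -> 'M[powser k n]_d.+1} :=
  horner_mx C \o map_poly (in_alg (powser k n)).
have evX : ev 'X = C by rewrite /= map_polyX horner_mx_X.
exists (ev s); first by rewrite /= trmx_horner_mx CT.
have -> : ev s *m ev s - C = ev h *m ev chi ^+ N.
  transitivity (ev (s ^+ 2 - 'X)); first by rewrite rmorphB rmorphXn evX.
  by rewrite sE rmorphM rmorphXn.
rewrite -[N]add0n; apply: mx_order_geM => //; apply/mx_order_geX/mx_order_ge1P.
rewrite /= map_horner_mx -map_poly_comp map_poly_id => [|c _].
  exact: Cayley_Hamilton.
exact: ps_at0_scalar.
Qed.

Section QuadraticForms.
Variables (R : comNzRingType) (n : nat).
Implicit Types (A B : 'M[R]_n) (x : 'cV[R]_n).

Definition qform B x : R := (x^T *m B *m x) 0 0.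
Definition sqsum x : R := \sum_i x i 0 ^+ 2.

Lemma qformE B x : qform B x = \sum_j \sum_i x i 0 * B i j * x j 0.
Proof.
rewrite /qform mxE; apply: eq_bigr => j _; rewrite !mxE mulr_suml.
by apply: eq_bigr => i _; rewrite !mxE.
Qed.

Lemma qformD A B x : qform (A + B) x = qform A x + qform B x.
Proof. by rewrite /qform mulmxDr mulmxDl mxE. Qed.

Lemma qformZ c B x : qform (c *: B) x = c * qform B x.
Proof. by rewrite /qform -scalemxAr -scalemxAl mxE. Qed.

Lemma qform_trmx B x : qform B^T x = qform B x.
Proof.
have -> : qform B x = (x^T *m B *m x)^T 0 0 by rewrite mxE.
by rewrite !trmx_mul trmxK mulmxA.
Qed.

Lemma qformB A B x : qform (A - B) x = qform A x - qform B x.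
Proof. by rewrite /qform mulmxBr mulmxBl !mxE. Qed.

Lemma qform_scalar c x : qform c%:M x = c * sqsum x.
Proof.
rewrite /qform mul_mx_scalar -scalemxAl !mxE; congr (_ * _).
by apply: eq_bigr => i _; rewrite !mxE expr2.
Qed.

Lemma exists_sym_qform (c : R) A : c * 2%:R = 1 ->
  exists2 B, B^T = B & forall x, qform B x = qform A x.
Proof.
move=> c2; exists (c *: (A + A^T)); first by rewrite linearZ linearD /= trmxK addrC.
by move=> x; rewrite qformZ qformD qform_trmx -mulr2n -mulr_natl mulrA c2 mul1r.
Qed.

Lemma sqsum_mulmx A x : sqsum (A *m x) = qform (A^T *m A) x.
Proof.
by rewrite -[LHS]mul1r -qform_scalar /qform mulmx1 trmx_mul !mulmxA.
Qed.

End QuadraticForms.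

(** * Comparison with the quadric *)

Lemma det_pencil (k : fieldType) r (A B : 'M[k]_r) :
  exists P : {poly k}, forall s, P.[s] = \det (A + s *: B).
Proof.
exists (\det (map_mx polyC A + 'X *: map_mx polyC B)) => s.
rewrite -[LHS]/(horner_eval s _) -det_map_mx; congr (\det _).
by apply/matrixP => i j; rewrite !mxE /= /horner_eval !hornerE.
Qed.

Lemma rank_pencil (k : fieldType) m n (A B : 'M[k]_(m, n)) :
  exists2 P : {poly k}, P != 0 &
    forall s, P.[s] != 0 -> (\rank A <= \rank (A + s *: B)%R)%N.
Proof.
pose L := pinvmx (col_base A); pose U := pinvmx (row_base A).
have LAU : L *m A *m U = 1%:M.
  have -> : L *m A = row_base A.
    by rewrite -[X in L *m X](mulmx_base A) mulmxA mulVpmx ?col_base_full // mul1mx.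
  by rewrite mulmxVp // row_base_free.
have [P PE] := det_pencil (L *m A *m U) (L *m B *m U).
exists P => [|s].
  have := PE 0; rewrite scale0r addr0 LAU det1.
  by apply: contra_eq_neq => ->; rewrite horner0 eq_sym oner_eq0.
rewrite PE scalemxAl scalemxAr -mulmxDl -mulmxDr => det0.
have <- : \rank (L *m (A + s *: B) *m U) = \rank A.
  by apply: mxrank_unit; rewrite unitmxE unitfE.
by apply: leq_trans (mxrankM_maxl _ _) _; exact: mxrankM_maxr.
Qed.

Section Substitution.
Variables (k : fieldType) (n q : nat).
Local Notation S := (powser k n).
Implicit Types (F G : S) (a b : monom n).
Hypothesis pchar_q : [pchar k].-nat q.

Variable y : 'I_n -> S.
Hypothesis y_max : forall i, maxideal (y i).

Definition meval a : S := \prod_i y i ^+ a i.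

Lemma meval0 : meval 0 = 1.
Proof. by rewrite /meval big1 // => i _; rewrite ffunE. Qed.

Lemma mevalD a b : meval (a + b) = meval a * meval b.
Proof. by rewrite /meval -big_split; apply: eq_bigr => i _; rewrite maddE exprD. Qed.

Lemma meval_var i : meval (mvar i) = y i.
Proof.
rewrite /meval (bigD1 i) //= ffunE eqxx expr1 big1 ?mulr1 // => j ji.
by rewrite ffunE (negbTE ji).
Qed.

Lemma xpow_ideal_meval a : a \notin box n q -> xpow_ideal q (meval a).
Proof.
rewrite mem_box negb_forall => /existsP[i]; rewrite -leqNgt => qi.
rewrite /meval (bigD1 i) //= mulrC -(subnK qi) exprD.
by apply/xpow_idealM/xpow_idealM/maxideal_frob.
Qed.

(* The endomorphism x_i |-> y_i of S / m^[q], acting on row vectors. *)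
Definition substmx : 'M[k]_(size (box n q)) :=
  \matrix_i trunc_row q (meval (box_monom i)).

Lemma trunc_row_psX_substmx a :
  trunc_row q (psX k a) *m substmx = trunc_row q (meval a).
Proof.
have [/box_monomP[i <-]|aq] := boolP (a \in box n q).
  by rewrite trunc_row_psX -rowE rowK.
by rewrite !(proj2 (trunc_row_eq0P q _)) ?mul0mx //;
  [apply: xpow_ideal_meval|apply: xpow_ideal_psX].
Qed.

Lemma meval_sub_substmx a : trunc_preim substmx (meval a).
Proof. by rewrite /trunc_preim /= -trunc_row_psX_substmx submxMl. Qed.

Lemma trunc_row_psXM_substmx a F G : trunc_row q F *m substmx = trunc_row q G ->
  trunc_row q (psX k a * F) *m substmx = trunc_row q (meval a * G).
Proof.
move=> FG; pose c i := trunc_row q F 0 i.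
have FE : trunc_row q F = trunc_row q (\sum_i c i *: psX k (box_monom i)).
  by rewrite -[LHS]row_seriesK.
have GE : trunc_row q G = trunc_row q (\sum_i c i *: meval (box_monom i)).
  rewrite -FG FE !linear_sum mulmx_suml; apply: eq_bigr => i _.
  by rewrite !linearZ /= -scalemxAl trunc_row_psX_substmx.
rewrite ![_ * F]mulrC ![_ * G]mulrC !trunc_rowM FE GE -!trunc_rowM.
rewrite !mulr_suml !linear_sum mulmx_suml; apply: eq_bigr => i _.
by rewrite -!scalerAl !linearZ /= -scalemxAl -psXD -mevalD trunc_row_psX_substmx.
Qed.

Hypothesis y_gen : forall F, maxideal F -> exists w, F = \sum_i w i * y i.

Lemma trunc_preim_substmxM F i :
  trunc_preim substmx F -> trunc_preim substmx (F * y i).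
Proof.
move=> FS; rewrite /trunc_preim /= trunc_rowM; apply: submx_trans (submxMr _ FS) _.
apply/row_subP => j; rewrite row_mul rowK -trunc_rowM -meval_var -mevalD.
exact: meval_sub_substmx.
Qed.

Lemma trunc_preim_substmx_dense N F :
  exists2 G, trunc_preim substmx G & order_ge N (F - G).
Proof.
elim: N F => [|N IH] F.
  by exists 0; rewrite /trunc_preim /= ?linear0 ?sub0mx.
have [w wE] := y_gen (maxideal_sub_at0 F).
have /choice[G GE] i : exists G, trunc_preim substmx G /\ order_ge N (w i - G).
  by have [G] := IH (w i); exists G.
exists ((ps_at0 F)%:A + \sum_i G i * y i).
  rewrite /trunc_preim /= linearD addmx_sub //.
    by rewrite linearZ scalemx_sub // -meval0; apply: meval_sub_substmx.
  rewrite linear_sum summx_sub // => i _.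
  by apply: trunc_preim_substmxM; case: (GE i).
have -> : F - ((ps_at0 F)%:A + \sum_i G i * y i) = \sum_i (w i - G i) * y i.
  by rewrite opprD addrA wE -sumrB; apply: eq_bigr => i _; rewrite mulrBl.
apply: is_ideal_sum => [|i _]; first exact: is_ideal_order_ge.
by rewrite -[N.+1]addn1; apply: order_geM; [case: (GE i)|apply/order_ge1P].
Qed.

Lemma substmx_unit : substmx \in unitmx.
Proof.
rewrite -row_full_unit -sub1mx; apply/row_subP => i; rewrite row1 -trunc_row_psX.
have [G GS] := trunc_preim_substmx_dense (n * q).+1 (psX k (box_monom i)).
by move=> /order_ge_xpow_ideal/trunc_row_eqP ->.
Qed.

Lemma rank_mulop_substmx F G : trunc_row q F *m substmx = trunc_row q G ->
  \rank (mulop q F) = \rank (mulop q G).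
Proof.
move=> FG; have free : row_free substmx by rewrite row_free_unit substmx_unit.
have full : row_full substmx by rewrite row_full_unit substmx_unit.
rewrite -(mxrankMfree _ free) -(eqmxMfull (mulop q G) full); congr mxrank.
apply/row_matrixP => i; rewrite !row_mul !rowK -trunc_rowM.
exact: trunc_row_psXM_substmx.
Qed.

End Substitution.

Section LinearSubstitution.
Variables (k : fieldType) (n q : nat).
Local Notation S := (powser k n).
Hypothesis pchar_q : [pchar k].-nat q.

Definition xcol : 'cV[S]_n := \col_i psX k (mvar i).

Lemma maxideal_xcol i : maxideal (xcol i 0).
Proof. by rewrite mxE; apply: maxideal_psX. Qed.

Lemma mulmx_xcol_gen (P : 'M[S]_n) F : P \in unitmx -> maxideal F ->
  exists w, F = \sum_i w i * (P *m xcol) i 0.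
Proof.
move=> P_unit /maxideal_sum[G ->]; pose v : 'rV[S]_n := \row_i G i.
exists (fun i => (v *m invmx P) 0 i).
transitivity ((v *m xcol) 0 0).
  by rewrite mxE; apply: eq_bigr => i _; rewrite !mxE mulrC.
by rewrite -{1}[xcol](mulKmx P_unit) [v *m _]mulmxA mxE.
Qed.

Lemma rank_mulop_sqsum_mulmx (P : 'M[S]_n) : P \in unitmx ->
  \rank (mulop q (sqsum xcol)) = \rank (mulop q (sqsum (P *m xcol))).
Proof.
move=> P_unit; pose y i := (P *m xcol) i 0.
have y_max i : maxideal (y i).
  rewrite /y mxE; apply: is_ideal_sum => [|j _]; first exact: is_ideal_maxideal.
  exact: is_idealM (is_ideal_maxideal k n) (maxideal_xcol j).
apply: (rank_mulop_substmx pchar_q y_max) => [F|]; first exact: mulmx_xcol_gen.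
rewrite !linear_sum mulmx_suml; apply: eq_bigr => i _.
by rewrite mxE !expr2 -psXD trunc_row_psX_substmx // mevalD meval_var.
Qed.

End LinearSubstitution.

Section MorseLemma.
Variables (k : closedFieldType) (d q : nat).
Local Notation n := d.+1.
Local Notation S := (powser k n).
Local Notation x := (xcol k n).
Hypothesis k2 : 2%:R != 0 :> k.
Hypothesis pchar_q : [pchar k].-nat q.

Lemma order_ge_qform N (B : 'M[S]_n) : mx_order_ge N B -> order_ge N (qform B x).
Proof.
move=> oB; rewrite qformE; have idN := is_ideal_order_ge k n N.
apply: is_ideal_sum => // j _; apply: is_ideal_sum => // i _.
by rewrite mulrAC mulrC -[N]addn0; apply: order_geM.
Qed.

Lemma order_ge2_qform (f : S) : order_ge 2 f -> exists2 B, B^T = B & f = qform B x.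
Proof.
move=> /order_geS_sum[G fG oG].
have /choice[H HE] i : exists H : 'I_n -> S, G i = \sum_j psX k (mvar j) * H j.
  by apply/maxideal_sum/order_ge1P.
pose A : 'M[S]_n := \matrix_(i, j) H i j.
have fA : f = qform A x.
  rewrite qformE exchange_big fG; apply: eq_bigr => i _; rewrite HE mulr_sumr.
  by apply: eq_bigr => j _; rewrite !mxE -mulrA [H i j * _]mulrC.
have [|B BT BA] := @exists_sym_qform _ _ (2%:R^-1)%:A A; last by exists B; rewrite ?BA.
by rewrite mulr_algl -(scaler_nat 2 1) scalerA mulVf ?scale1r.
Qed.

Lemma rank_mulop_nondegenerate_qform (C : 'M[S]_n) : C^T = C -> C \in unitmx ->
  \rank (mulop q (sqsum x)) = \rank (mulop q (qform C x)).
Proof.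
move=> CT C_unit; have [P PT PC] := sym_mx_sqrt (n * q).+1 k2 CT C_unit.
have P_unit : P \in unitmx.
  have /mx_order_ge1P/eqP : mx_order_ge 1 (P *m P - C).
    by move=> i j m m1; apply: PC; apply: leq_trans m1 _.
  rewrite map_mxB subr_eq0 map_mxM unitmx_at0 => /eqP PP.
  by move: C_unit; rewrite unitmx_at0 -PP unitmx_mul => /andP[].
have /eq_mulop <- : xpow_ideal q (qform (P *m P) x - qform C x).
  by rewrite -qformB; apply/order_ge_xpow_ideal/order_ge_qform.
by rewrite (rank_mulop_sqsum_mulmx pchar_q P_unit) sqsum_mulmx PT.
Qed.

Lemma colength_sqsum_leq (f : S) : order_ge 2 f ->
  (colength q (sqsum x) <= colength q f)%N.
Proof.
move=> /order_ge2_qform[B BT ->]; apply: leq_sub2l.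
have [P P0 rank_P] := rank_pencil (mulop q (qform B x)) (- mulop q (sqsum x)).
pose chi := char_poly (map_mx (@ps_at0 k n) B).
have [s] : exists s, ~~ root (P * chi) s.
  by apply/closed_nonrootP; rewrite mulf_neq0 // monic_neq0 // char_poly_monic.
rewrite rootM negb_or => /andP[/rank_P rank_s chi_s]; apply: leq_trans rank_s _.
rewrite scalerN -linearZ -linearB -mulr_algl -qform_scalar -qformB.
rewrite (@rank_mulop_nondegenerate_qform (B - s%:A%:M)) //.
  by rewrite linearB /= tr_scalar_mx BT.
rewrite unitmx_at0 map_mxB map_scalar_mx [X in X%:M]ps_at0_scalar.
by rewrite unitmx_sub_scalar.
Qed.

End MorseLemma.

(** * Hilbert-Kunz multiplicity *)

Section Hypersurface.
Variables (k : fieldType) (d : nat).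
Local Notation S := (powser k d.+1).
Local Notation x i := (psX k (mvar i)).
Implicit Types (f : S) (I : set S).

Lemma coef_mvar_sum (G : 'I_d.+1 -> S) i : (\sum_j x j * G j) (mvar i) = G i 0.
Proof.
rewrite ps_sumE (bigD1 i) //= psXME big1 ?addr0 => [|j ji]; last first.
  rewrite psXME; case: mdvdP => // /(_ j).
  by rewrite !ffunE eqxx (negbTE ji).
case: mdvdP => [_|[]//]; congr (G i _); apply/ffunP => l; by rewrite !ffunE subnn.
Qed.

Lemma is_ideal_mvar_elim I f i : is_ideal I -> maxideal f -> f (mvar i) != 0 ->
  I f -> (forall j, j != i -> I (x j)) -> I (x i).
Proof.
move=> idI /maxideal_sum[G fG]; rewrite {1}fG coef_mvar_sum -ps_unitE => Gi If Ix.
have -> : x i = (G i)^-1 * (f - \sum_(j | j != i) G j * x j).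
  rewrite fG (bigD1 i) //= [X in _ + X - _](eq_bigr (fun j => G j * x j)) => [|j _].
    by rewrite addrK mulrC mulrK.
  by rewrite mulrC.
apply: is_idealM => //; apply: is_idealB => //; apply: is_ideal_sum => // j ji.
by apply: is_idealM => //; apply: Ix.
Qed.

Lemma singular_order_ge2 f : maxideal f ->
  ~ (exists g : 'I_d -> S, ideal_gen ([set f] `|` range g) = @maxideal k d.+1) ->
  order_ge 2 f.
Proof.
move=> fm singular m; rewrite ltnS leq_eqVlt ltnS leqn0 mdeg_eq0.
case/orP => [/eqP/mdeg_eq1[i ->]|/eqP -> //].
apply/eqP/negPn/negP => fi; apply: singular.
exists (fun j => x (lift i j)); apply/seteqP; split.
  apply: ideal_gen_min => [|F [->//|[j _ <-]]]; first exact: is_ideal_maxideal.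
  exact: maxideal_psX.
set I := ideal_gen _; have idI : is_ideal I by apply: is_ideal_gen.
have Ix j : j != i -> I (x j).
  case: (unliftP i j) => [l -> _|->]; last by rewrite eqxx.
  by apply: sub_ideal_gen; right; exists l.
rewrite -xpow_ideal1; apply: xpow_ideal_min => // j; have [->|/Ix//] := eqVneq j i.
by apply: (is_ideal_mvar_elim idI fm fi) => //; apply: sub_ideal_gen; left.
Qed.

Lemma quadricE : @quadric k d.+1 = sqsum (xcol k d.+1).
Proof.
rewrite /sqsum -big_enum /= /quadric; elim: (enum _) => [|i s IH] /=.
  by rewrite big_nil.
by rewrite big_cons IH mxE.
Qed.

Lemma quadric_neq0 : @quadric k d.+1 != 0.
Proof.
apply/eqP => /(congr1 (fun F : S => F (mvar ord0 *+ 2))).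
rewrite quadricE /sqsum ps_sumE (bigD1 ord0) //= mxE -psXMn /psX eqxx big1 => [/eqP|i i0].
  by rewrite addr0 oner_eq0.
rewrite mxE -psXMn /psX; case: eqP => // /ffunP/(_ i).
by rewrite !mmulnE !ffunE eqxx (negbTE i0).
Qed.

End Hypersurface.

Section HilbertKunz.
Variables (R : realType) (k : fieldType) (p d : nat).
Implicit Types f : powser k d.+1.
Hypothesis pk : p \in [pchar k].

Lemma pchar_pnat_exp e : [pchar k].-nat (p ^ e)%N.
Proof. by rewrite pnatX pnatE ?pk // (pcharf_prime pk). Qed.

Definition hk_seq f : R^nat := fun e => (colength (p ^ e) f)%:R / ((p ^ e) ^ d)%:R.

Lemma eHK_colength f : eHK R p f = limn (hk_seq f).
Proof.
by congr (limn _); apply/funext => e; rewrite qlength_frob_ideal // pchar_pnat_exp.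
Qed.

Let p_gt0 : (0 < p)%N. Proof. exact: prime_gt0 (pcharf_prime pk). Qed.

Let denominator_gt0 e : 0 < ((p ^ e) ^ d)%:R :> R.
Proof. by rewrite ltr0n !expn_gt0 p_gt0. Qed.

Lemma hk_seq_nondecreasing f : nondecreasing_seq (hk_seq f).
Proof.
apply/nondecreasing_seqP => e; rewrite /hk_seq ler_pdivrMr ?denominator_gt0 // -mulrAC.
rewrite ler_pdivlMr ?denominator_gt0 // -!natrM ler_nat -(leq_pmul2l p_gt0).
have := colength_frob (p ^ e) (pchar_pnat_exp 1) f; rewrite expn1 -expnS.
set c := colength _ f; set c' := colength _ f => frob.
have -> : (p * (c * (p ^ e.+1) ^ d) = p ^ d.+1 * c * (p ^ e) ^ d)%N.
  by rewrite !expnS expnMn; ring.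
by rewrite mulnA leq_mul2r frob orbT.
Qed.

Lemma is_cvg_hk_seq f : f != 0 -> cvgn (hk_seq f).
Proof.
move=> /colength_bounded[C f_bound]; apply: nondecreasing_is_cvgn.
  exact: hk_seq_nondecreasing.
exists C%:R => _ [e _ <-].
rewrite /hk_seq ler_pdivrMr ?denominator_gt0 // -natrM ler_nat.
by rewrite f_bound // expn_gt0 p_gt0.
Qed.

End HilbertKunz.

Theorem theorem3p2 (R : realType) (k : closedFieldType) (p d : nat)
  (f : powser k d.+1)
  (Hunc : uncountable k)
  (Hp : p \in [pchar k]%R) (Hp2 : p != 2%N)
  (Hf0 : f <> @ps_zero k d.+1)
  (Hfm : @maxideal k d.+1 f)
  (Hsing : ~ exists g : 'I_d -> powser k d.+1,
             ideal_gen ([set f] `|` range g) = @maxideal k d.+1) :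
  eHK R p (@quadric k d.+1) <= eHK R p f.
Proof.
have k2 : 2%:R != 0 :> k.
  apply: contra Hp2 => k20; have : 2%N \in [pchar k] by rewrite inE /= k20.
  by rewrite (pcharf_eq Hp) => /eqP <-.
rewrite !(eHK_colength _ Hp); apply: ler_lim.
- by apply: is_cvg_hk_seq => //; apply: quadric_neq0.
- by apply: is_cvg_hk_seq => //; apply/eqP.
near=> e; rewrite /hk_seq ler_wpM2r ?invr_ge0 ?ler0n // ler_nat quadricE.
apply: colength_sqsum_leq => //; first exact: pchar_pnat_exp.
exact: singular_order_ge2.
Unshelve. all: by end_near.
Qed.
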